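(* Let $K$ be a field of characteristic $2$ and let $q = 2^{\alpha}$ with $\alpha$ a positive integer. Let $n$ be an integer with $0 < n \leq q$, with consecutive-ones binary expansion $n = \sum_{1 \leq i \leq r} (-1)^{i+1} 2^{\beta_i}$, where $\beta_1 > \cdots > \beta_r \geq 0$. For $1 \leq k \leq r$ with $\beta_k > 0$, define $$d_k := 2^{\beta_k - 1} + \sum_{k < i \leq r} (-1)^{k+i} 2^{\beta_i}.$$ Then $$\wedge^2(W_n) \cong \bigoplus_{\substack{1 \leq k \leq r \\ \beta_k > 0}} W_{2^{\beta_k}-1}^{d_k}$$ as $\mathfrak{w}_q$-modules.
   Context: The consecutive-ones binary expansion of an integer $n > 0$ is the alternating sum $n = \sum_{1 \leq i \leq r} (-1)^{i+1} 2^{\beta_i}$ such that $\beta_1 > \cdots > \beta_r \geq 0$ and $r$ is minimal (e.g. $3 = 2^2 - 2^0$, $4 = 2^2$, $5 = 2^3 - 2^2 + 2^0$, $6 = 2^3-2^1$). $\mathfrak{w}_q$ is the abelian $2$-Lie algebra (restricted Lie algebra) over $K$ generated by a single nilpotent element $e$ with $e^{[q]} = 0$, so $\mathfrak{w}_q = \bigoplus_{0 \leq i < \alpha} \langle e^{[2^i]} \rangle$ as a vector space. In a restricted module $e^{[2^i]}$ acts as the $2^i$-th power of the action of $e$, so a restricted $\mathfrak{w}_q$-module is the same as a $K$-vector space with an endomorphism $e$ such that $e^q = 0$. The indecomposable restricted $\mathfrak{w}_q$-modules are $W_1, \ldots, W_q$, where $\dim W_i = i$ and $e$ acts on $W_i$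 as a single $i \times i$ nilpotent Jordan block. Set $W_0 = 0$. For a module $W$, $W^0 = 0$ and $W^d$ is the direct sum of $d$ copies of $W$ for $d>0$. The exterior square carries the Lie algebra action $e \cdot (v \wedge w) = ev \wedge w + v \wedge ew$. *)

(* Defs.v *)
From HB Require Import structures.
From mathcomp Require Import all_boot all_order all_algebra.

Set Implicit Arguments.
Unset Strict Implicit.
Unset Printing Implicit Defensive.

Import Order.TTheory GRing.Theory Num.Theory.
Local Open Scope ring_scope.

(* Exponents are stored as a list and indexed from 0, so the sign of the i-th
   term is (-1)^i instead of (-1)^(i+1). *)
Definition altsum (b : seq nat) : int :=
  \sum_(i < size b) (-1) ^+ i * 2 ^+ nth 0%N b i.

Definition consecutive_ones (n : nat) (b : seq nat) : Prop :=
  [/\ sorted gtn b, altsum b = n%:Z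
    & forall b', sorted gtn b' -> altsum b' = n%:Z -> (size b <= size b')%N].

Definition dcoef (b : seq nat) (k : nat) : int :=
  2 ^+ (nth 0%N b k).-1
  + \sum_(i < size b | (k < i)%N) (-1) ^+ (k + i) * 2 ^+ nth 0%N b i.

Lemma altsum_nil : altsum [::] = 0.
Proof. by rewrite /altsum big_ord0. Qed.

Lemma altsum_cons x s : altsum (x :: s) = 2 ^+ x - altsum s.
Proof.
rewrite /altsum /= big_ord_recl /= expr0 mul1r; congr (_ + _).
rewrite -sumrN; apply: eq_bigr => i _.
by rewrite /bump /= add1n exprS mulN1r mulNr.
Qed.

Lemma altsum_cat s t :
  altsum (s ++ t) = altsum s + (-1) ^+ size s * altsum t.
Proof.
elim: s => [|x s IHs] /=; first by rewrite altsum_nil expr0 mul1r add0r.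
by rewrite !altsum_cons IHs exprS mulN1r mulNr opprD addrA.
Qed.

Lemma altsum_bound x s : path gtn x s -> 0 <= altsum s < 2 ^+ x.
Proof.
elim: s x => [|y s IHs] x /=; first by rewrite altsum_nil lexx exprn_gt0.
case/andP=> lt_yx /IHs/andP[s_ge0 s_lt]; rewrite altsum_cons subr_ge0 ltW //=.
apply: le_lt_trans (_ : 2 ^+ y < _); first by rewrite lerBlDr lerDl.
by rewrite ltr_eXn2l.
Qed.

Lemma altsum_eq0 x s : path gtn x s -> altsum s = 0 -> s = [::].
Proof.
case: s => [|y s] //= /andP[_ /altsum_bound/andP[_ s_lt]].
by rewrite altsum_cons => /eqP; rewrite subr_eq0 => /eqP eq_s; rewrite eq_s ltxx in s_lt.
Qed.

Lemma consecutive_ones_end n p y z :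
  consecutive_ones n (p ++ [:: y; z]) -> (z.+1 < y)%N.
Proof.
case=> srt sum_n minb; rewrite ltn_neqAle.
have lt_zy : (z < y)%N.
  move: srt; case: p {sum_n minb} => [|a p] /=; first by rewrite andbT.
  by rewrite cat_path /= andbT => /and3P[].
rewrite lt_zy andbT; apply/eqP => def_y; subst y.
have := minb (p ++ [:: z]); rewrite !size_cat /= leq_add2l ltnn => H.
suff: false by []. apply: H.
  case: p srt {sum_n minb} => [|a p] //=.
  rewrite !cat_path /= !andbT => /and3P[-> /= lt1 _].
  by apply: ltn_trans lt1.
rewrite -sum_n !altsum_cat !altsum_cons altsum_nil; congr (_ + _ * _).
by rewrite !subr0 exprS mulr_natl mulr2n addrK.
Qed.

Lemma consecutive_ones_tail n p y s :
  consecutive_ones n (p ++ y :: s) -> (0 < y)%N -> altsum s < 2 ^+ y.-1.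
Proof.
case: y => // y exp_n _ /=.
have: path gtn y.+1 s.
  have [+ _ _] := exp_n; case: p {exp_n} => [|a p] //=.
  by rewrite cat_path /= => /and3P[].
case: s exp_n => [|z s] exp_n /=; first by rewrite altsum_nil exprn_gt0.
case/andP=> lt_zy' path_s; have le_zy : (z <= y)%N := lt_zy'.
have /andP[s_ge0 s_lt] := altsum_bound path_s.
rewrite altsum_cons; move: le_zy {lt_zy'}; rewrite leq_eqVlt => /orP[/eqP eq_zy | lt_zy].
  subst z; have: altsum s != 0.
    apply/eqP => /(altsum_eq0 path_s) s0; subst s.
    by have := consecutive_ones_end exp_n; rewrite ltnn.
  by move=> s_n0; rewrite ltrBlDr ltrDl lt_def s_n0.
apply: le_lt_trans (_ : 2 ^+ z < _); first by rewrite lerBlDr lerDl.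
by rewrite ltr_eXn2l.
Qed.

Lemma dcoefE b k : (k < size b)%N ->
  dcoef b k = 2 ^+ (nth 0%N b k).-1 - altsum (drop k.+1 b).
Proof.
move=> lt_kb; congr (_ + _).
rewrite -(big_mkord (fun i => (k < i)%N)
            (fun i => (-1) ^+ (k + i) * 2 ^+ nth 0%N b i)).
rewrite (big_cat_nat (n := k.+1)) //= big_nat_cond big_pred0 ?add0r; last first.
  by move=> i; rewrite /= ltnS ltnNge; case: leqP.
rewrite /altsum size_drop -sumrN -[k.+1 in LHS]add0n big_addn big_mkord.
apply: eq_big => [i|i _]; first exact: leq_addl.
rewrite nth_drop [in nth _ _ _]addnC -mulNr; congr (_ * _).
rewrite addnCA !addnS addnn exprS mulN1r exprD -[(-1) ^+ k.*2]signr_odd.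
by rewrite odd_double mulr1.
Qed.

(* Hence the absolute value of d_k, as a natural number, is d_k itself. *)
Lemma dcoef_gt0 n b k : consecutive_ones n b ->
  (k < size b)%N -> (0 < nth 0%N b k)%N -> 0 < dcoef b k.
Proof.
move=> exp_n lt_kb bk_gt0; rewrite dcoefE // subr_gt0.
apply: (consecutive_ones_tail (n := n) (p := take k b)) => //.
by rewrite -drop_nth // cat_take_drop.
Qed.

Lemma consecutive_ones_bound alpha n b k :
  consecutive_ones n b -> (n <= 2 ^ alpha)%N -> (k < size b)%N ->
  (2 ^ nth 0%N b k - 1 <= 2 ^ alpha)%N.
Proof.
move=> exp_n le_n lt_kb; apply: leq_trans (leq_subr _ _) _.
rewrite leq_exp2l //; case: b exp_n lt_kb => // x s exp_n lt_k.
have [srt sum_n _] := exp_n.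
have le_x : (nth 0%N (x :: s) k <= x)%N.
  case: k lt_k => //= k lt_k; apply: ltnW.
  have /allP := order_path_min (rev_trans ltn_trans) srt.
  by apply; apply: mem_nth.
apply: leq_trans le_x _; case: x exp_n srt sum_n {lt_k} => // x exp_n _ sum_n.
have := consecutive_ones_tail (p := [::]) exp_n isT => /= s_lt.
rewrite ltnNge; apply/negP => le_ax.
suff: (2 ^ x < n)%N by rewrite ltnNge (leq_trans le_n) ?leq_exp2l.
rewrite -(ltr_nat int) natrX [n%:R]natz -sum_n altsum_cons exprS mulr_natl mulr2n.
by rewrite -addrA ltrDl subr_gt0.
Qed.

(* The restricted 2-Lie algebra w_q is generated by e, and e^[2^i] acts as the
   2^i-th power of e: a (finite-dimensional) restricted w_q-module is a vector
   space with an endomorphism e such that e^q = 0, and commuting with e is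
   commuting with all of w_q. *)
Record wmod (K : fieldType) (q : nat) := WMod {
  wsort :> vectType K;
  wact : 'End(wsort);
  wact_nilp : forall v : wsort, iter q wact v = 0
}.
Arguments WMod {K q}.
Arguments wact {K q}.

Definition wmod_iso (K : fieldType) (q : nat) (M N : wmod K q) : Prop :=
  exists f : {linear M -> N},
    bijective f /\ forall v : M, f (wact M v) = wact N (f v).

Section Constructions.
Variables (K : fieldType) (q : nat).
Implicit Types M N : wmod K q.

Lemma wzero_nilp (v : 'rV[K]_0) : iter q (0 : 'End('rV[K]_0)) v = 0.
Proof. exact: thinmx0. Qed.

Definition wzero : wmod K q := WMod 'rV[K]_0 0 wzero_nilp.

Definition wsum_fun M N (p : M * N) : M * N := (wact M p.1, wact N p.2).

Lemma wsum_fun_linear M N : linear (@wsum_fun M N).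
Proof. by move=> a p p'; rewrite /wsum_fun !linearP. Qed.

HB.instance Definition _ M N :=
  GRing.isLinear.Build K _ _ *:%R (@wsum_fun M N) (@wsum_fun_linear M N).

Lemma wsum_nilp M N (p : M * N) : iter q (linfun (@wsum_fun M N)) p = 0.
Proof.
suff E i : iter i (linfun (@wsum_fun M N)) p
           = (iter i (wact M) p.1, iter i (wact N) p.2).
  by rewrite E !wact_nilp.
elim: i => [|i IHi]; first by case: p.
by rewrite !iterS IHi lfunE.
Qed.

Definition wsum M N : wmod K q :=
  WMod (M * N)%type (linfun (@wsum_fun M N)) (@wsum_nilp M N).

Definition wcopies M (d : nat) : wmod K q := iter d (wsum M) wzero.

Definition jordan n : 'M[K]_n := \matrix_(i, j) (i.+1 == j :> nat)%:R.

Definition jordan_lfun n : 'End('rV[K]_n) := linfun (mulmxr (jordan n)).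

Lemma jordan_nilp n : (n <= q)%N ->
  forall v : 'rV[K]_n, iter q (jordan_lfun n) v = 0.
Proof.
move=> le_nq v.
have E i : forall j : 'I_n, (j < i)%N -> iter i (jordan_lfun n) v 0 j = 0.
  elim: i => // i IHi j lt_ji; rewrite iterS lfunE /= mxE big1 // => k _.
  rewrite mxE; case: eqP => [def_j | _]; last by rewrite mulr0.
  by rewrite IHi ?mul0r // -ltnS def_j.
apply/rowP => j; rewrite E ?mxE //; exact: leq_trans (ltn_ord j) le_nq.
Qed.

Definition W n (le_nq : (n <= q)%N) : wmod K q :=
  WMod 'rV[K]_n (jordan_lfun n) (jordan_nilp le_nq).

End Constructions.

Definition alternating (K : fieldType) (V U : lmodType K) (f : V -> V -> U) :=
  [/\ forall v, linear (f v), forall w, linear (f^~ w) & forall v, f v v = 0].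

Definition exterior_square (K : fieldType) (V L : lmodType K)
    (wdg : V -> V -> L) : Prop :=
  alternating wdg /\
  forall (U : lmodType K) (f : V -> V -> U), alternating f ->
    exists g : {linear L -> U},
      (forall v w, g (wdg v w) = f v w) /\
      (forall h : {linear L -> U}, (forall v w, h (wdg v w) = f v w) -> h =1 g).

(* V (x) V is the space of square matrices (with v (x) w the product of the
   coordinate column of v by the coordinate row of w), and the exterior square
   is the image of V (x) V under x |-> x - x^T, with v /\ w the image of
   v (x) w; the kernel of that map is the span of the squares v (x) v. See
   exterior_squareP and ext2_act_wedge below for the characterization. *)
Section ExteriorSquare.
Variables (K : fieldType) (V : vectType K).
Local Notation m := (\dim {:V}).
Local Notation X := (vbasis {:V}).

Definition coords (v : V) : 'rV[K]_m := \row_i coord X i v.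

Lemma coords_linear : linear coords.
Proof. by move=> a u v; apply/rowP => i; rewrite !mxE linearP. Qed.

HB.instance Definition _ :=
  GRing.isLinear.Build K V 'rV[K]_m *:%R coords coords_linear.

Lemma coordsK v : v = \sum_i coords v 0 i *: X`_i.
Proof.
by rewrite {1}(coord_vbasis (memvf v)); apply: eq_bigr => i _; rewrite mxE.
Qed.

Lemma coords_basis (i : 'I_m) : coords X`_i = delta_mx 0 i.
Proof.
apply/rowP => j; rewrite !mxE eqxx /= eq_sym coord_free //.
exact: basis_free (vbasisP _).
Qed.

Definition tensor (v w : V) : 'M[K]_m := (coords v)^T *m coords w.

Definition antisym_fun (A : 'M[K]_m) : 'M[K]_m := A - A^T.

Lemma antisym_fun_linear : linear antisym_fun.
Proof.
by move=> a A B; rewrite /antisym_fun [_^T]linearP /= scalerBr opprD addrACA.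
Qed.

HB.instance Definition _ :=
  GRing.isLinear.Build K 'M[K]_m 'M[K]_m *:%R antisym_fun antisym_fun_linear.

Definition antisym : 'End('M[K]_m) := linfun antisym_fun.

Definition ext2 : vectType K := subvs_of (limg antisym).

Definition wedge (v w : V) : ext2 := vsproj (limg antisym) (antisym (tensor v w)).

Lemma val_wedge v w : vsval (wedge v w) = tensor v w - tensor w v.
Proof.
rewrite vsprojK ?memv_img ?memvf // lfunE /= /antisym_fun.
by rewrite /tensor trmx_mul trmxK.
Qed.

Lemma tensorPr v a w w' :
  tensor v (a *: w + w') = a *: tensor v w + tensor v w'.
Proof. by rewrite /tensor linearP /= mulmxDr -scalemxAr. Qed.

Lemma tensorPl w a v v' :
  tensor (a *: v + v') w = a *: tensor v w + tensor v' w.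
Proof.
by rewrite /tensor [coords _]linearP [(_ + _)^T]linearP /= mulmxDl -scalemxAl.
Qed.

Lemma wedge_alternating : alternating wedge.
Proof.
split=> [v a w w'|w a v v'|v]; apply: val_inj; last by rewrite /= val_wedge subrr.
  rewrite [RHS]linearP /= !val_wedge tensorPr tensorPl.
  by rewrite scalerBr opprD addrACA.
rewrite [RHS]linearP /= !val_wedge tensorPr tensorPl.
by rewrite scalerBr opprD addrACA.
Qed.

Lemma ext2_span (x : ext2) :
  exists B : 'M[K]_m, x = \sum_i \sum_j B i j *: wedge X`_i X`_j.
Proof.
have /memv_imgP[B _ def_x] := subvsP x; exists B; apply: val_inj.
rewrite /= def_x linear_sum /= lfunE /= /antisym_fun.
have sumB : B = \sum_i \sum_j B i j *: delta_mx i j := matrix_sum_delta B.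
have sumBT : B^T = \sum_i \sum_j B i j *: delta_mx j i.
  rewrite {1}sumB linear_sum; apply: eq_bigr => i _.
  by rewrite linear_sum; apply: eq_bigr => j _; rewrite linearZ /= trmx_delta.
rewrite sumBT {1}sumB -sumrB; apply: eq_bigr => i _.
rewrite [RHS]linear_sum -sumrB; apply: eq_bigr => j _.
rewrite [RHS]linearZ /= -scalerBr val_wedge /tensor !coords_basis !trmx_delta.
by rewrite !mul_delta_mx.
Qed.

Lemma alternatingN (U : lmodType K) (f : V -> V -> U) v w :
  alternating f -> f w v = - f v w.
Proof.
case=> linr linl f0; apply/eqP; rewrite -addr_eq0; apply/eqP.
have addl u u' x : f (u + u') x = f u x + f u' x.
  by have := linl x 1 u u'; rewrite !scale1r.
have addr u x x' : f u (x + x') = f u x + f u x'.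
  by have := linr u 1 x x'; rewrite !scale1r.
by have := f0 (v + w); rewrite addl !addr !f0 add0r addr0 addrC.
Qed.

Theorem exterior_squareP : exterior_square wedge.
Proof.
split=> [|U f altf]; first exact: wedge_alternating.
pose gf (x : ext2) : U :=
  \sum_(i < m) \sum_(j < m | (i < j)%N) vsval x i j *: f X`_i X`_j.
have gfL : linear gf.
  move=> a x y; rewrite /gf scaler_sumr -big_split; apply: eq_bigr => i _ /=.
  rewrite scaler_sumr -big_split; apply: eq_bigr => j _ /=.
  by rewrite !mxE scalerDl scalerA.
pose gM := GRing.isLinear.Build K ext2 U *:%R gf gfL.
pose g : {linear ext2 -> U} := HB.pack gf gM.
have gE v w : g (wedge v w) = f v w.
  have [linr linl f0] := altf.
  pose fl w := GRing.isLinear.Build K V U *:%R (f^~ w) (linl w).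
  pose Fl w : {linear V -> U} := HB.pack (f^~ w) (fl w).
  pose fr v := GRing.isLinear.Build K V U *:%R (f v) (linr v).
  pose Fr v : {linear V -> U} := HB.pack (f v) (fr v).
  have -> : f v w = \sum_(i < m) \sum_(j < m) (coords v 0 i * coords w 0 j) *: f X`_i X`_j.
    rewrite {1}[v]coordsK -[LHS]/(Fl w _) linear_sum; apply: eq_bigr => i _.
    rewrite linearZ /= {1}[w]coordsK -[f _ _]/(Fr X`_i _) linear_sum scaler_sumr.
    by apply: eq_bigr => j _; rewrite linearZ /= scalerA.
  pose G (i j : 'I_m) := (coords v 0 i * coords w 0 j) *: f X`_i X`_j.
  rewrite -[RHS]/(\sum_(i < m) \sum_(j < m) G i j).
  have -> : \sum_(i < m) \sum_(j < m) G i j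
     = \sum_(i < m) \sum_(j < m | (i < j)%N) G i j + \sum_(i < m) \sum_(j < m | (i < j)%N) G j i.
    rewrite [X in _ = _ + X](exchange_big_dep predT) //= -big_split.
    apply: eq_bigr => i _ /=; rewrite (bigID (fun j : 'I_m => (i < j)%N)) /=.
    congr (_ + _); rewrite (bigD1 i) ?ltnn //= /G f0 scaler0 add0r.
    apply: eq_bigl => j; rewrite -leqNgt ltn_neqAle andbC; congr (_ && _).
  rewrite -big_split; apply: eq_bigr => i _ /=; rewrite -big_split.
  apply: eq_bigr => j _ /=; rewrite val_wedge /G (alternatingN X`_i X`_j altf).
  rewrite scalerN -scalerBl /tensor !mxE !big_ord1 !mxE.
  by congr ((_ - _) *: _); rewrite mulrC.
exists g; split=> // h hE x; have [B ->] := ext2_span x.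
rewrite !linear_sum; apply: eq_bigr => i _; rewrite !linear_sum.
by apply: eq_bigr => j _; rewrite !linearZ gE hE.
Qed.

Variable e : 'End(V).

Definition act_mx : 'M[K]_m := \matrix_i coords (e X`_i).

Lemma coords_act v : coords (e v) = coords v *m act_mx.
Proof.
rewrite {1}[v]coordsK !linear_sum /= mulmx_sum_row; apply: eq_bigr => i _.
by rewrite !linearZ /= rowK.
Qed.

Definition ext2_fun (x : ext2) : ext2 :=
  vsproj (limg antisym) (act_mx^T *m vsval x + vsval x *m act_mx).

Lemma ext2_fun_linear : linear ext2_fun.
Proof.
move=> a x y; rewrite /ext2_fun -linearP; congr (vsproj _ _).
have -> : vsval (a *: x + y) = a *: vsval x + vsval y by rewrite linearP.
by rewrite mulmxDr mulmxDl -scalemxAr -scalemxAl scalerDr addrACA.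
Qed.

HB.instance Definition _ :=
  GRing.isLinear.Build K ext2 ext2 *:%R ext2_fun ext2_fun_linear.

Definition ext2_act : 'End(ext2) := linfun ext2_fun.

Theorem ext2_act_wedge v w :
  ext2_act (wedge v w) = wedge (e v) w + wedge v (e w).
Proof.
rewrite lfunE /= /ext2_fun.
have -> : act_mx^T *m vsval (wedge v w) + vsval (wedge v w) *m act_mx
          = vsval (wedge (e v) w + wedge v (e w)).
  rewrite linearD /= !val_wedge /tensor !coords_act !trmx_mul.
  rewrite mulmxBr mulmxBl !mulmxA addrACA.
  by rewrite [- _ - _]addrC addrACA.
exact: vsvalK.
Qed.

End ExteriorSquare.

Lemma iter_ext2_act (K : fieldType) (V : vectType K) (e : 'End(V)) (a : nat) :
  2%N \in [pchar K] -> forall v w : V,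
  iter (2 ^ a) (ext2_act e) (wedge v w)
  = wedge (iter (2 ^ a) e v) w + wedge v (iter (2 ^ a) e w).
Proof.
move=> char2; have [linr linl _] := wedge_alternating V.
have itD i (x y : ext2 V) :
  iter i (ext2_act e) (x + y) = iter i (ext2_act e) x + iter i (ext2_act e) y.
  by elim: i => //= i ->; rewrite linearD.
elim: a => [|a IHa] v w; first by rewrite /= ext2_act_wedge.
rewrite expnS mul2n -addnn !iterD IHa itD !IHa.
have y2 (y : ext2 V) : y + y = 0.
  by rewrite -mulr2n -scaler_nat (pcharf0 char2) scale0r.
by rewrite -addrA [X in _ + X]addrA y2 add0r.
Qed.

Lemma ext2_nilp (K : fieldType) (alpha : nat) (M : wmod K (2 ^ alpha)) :
  2%N \in [pchar K] ->
  forall x : ext2 M, iter (2 ^ alpha) (ext2_act (wact M)) x = 0.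
Proof.
move=> char2 x; have [B ->] := ext2_span x.
have [linr linl _] := wedge_alternating M.
have w0r (v : M) : wedge v 0 = 0.
  by have := linr v (-1) 0 0; rewrite scaler0 addr0 scaleN1r addNr.
have w0l (w : M) : wedge 0 w = 0.
  by have := linl w (-1) 0 0; rewrite scaler0 addr0 scaleN1r addNr.
have itL i : linear (iter i (ext2_act (wact M))).
  by move=> a u v; elim: i => //= i ->; rewrite linearP.
set it := iter _ _.
pose itM := GRing.isLinear.Build K (ext2 M) (ext2 M) *:%R it (itL _).
pose h : {linear ext2 M -> ext2 M} := HB.pack it itM.
rewrite -[it]/(h : _ -> _) linear_sum big1 // => i _.
rewrite linear_sum big1 // => j _; rewrite linearZ /= /it.
by rewrite iter_ext2_act // !wact_nilp w0r w0l addr0 scaler0.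
Qed.

Definition wedge2 (K : fieldType) (char2 : 2%N \in [pchar K]) (alpha : nat)
    (M : wmod K (2 ^ alpha)) : wmod K (2 ^ alpha) :=
  WMod (ext2 M) (ext2_act (wact M)) (ext2_nilp char2).

(* Main.v *)
(* Write Q = 2^(y+1), h = 2^y, n = h + j and m = h - j = Q - n. In characteristic
   2, the 2^a-th power of the action of e on the exterior square is again a
   derivation, induced by e^(2^a). Put e_a = e^a e_0. The vectors
   v_l = e_l /\ e_(l+1) generate the exterior square of W_n under e, and e^(Q-1)
   kills them. Let F be the submodule generated by v_0, ..., v_(j-1). Since e^h
   kills v_l for l >= j, the image of e^h lies in F; in particular F contains
   e_h /\ e_b for b >= j, so that the shift e_a |-> e_(a+j) induces a map from the
   exterior square of W_m that commutes with e modulo F, and whose image spans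
   the whole space together with F. Counting dimensions, F is W_(Q-1)^j, with
   quotient the exterior square of W_m. As F is free over K[e]/(e^(Q-1)), an
   averaging argument splits it off. Iterating n |-> Q - n follows the
   consecutive-ones expansion of n. *)
Require Import Defs.
From HB Require Import structures.
From mathcomp Require Import all_boot all_order all_algebra.
From mathcomp Require Import zify.

Import GRing.Theory Num.Theory.
Local Open Scope ring_scope.

(** * Linear preliminaries: iterates, surjectivity and dimension *)

Lemma iter_is_linear (K : fieldType) (V : lmodType K) (k : nat)
  (e : {linear V -> V}) : linear (iter k e).
Proof. by move=> a u v; elim: k => //= k ->; rewrite linearP. Qed.

HB.instance Definition _ (K : fieldType) (V : lmodType K) (k : nat)
    (e : {linear V -> V}) :=
  GRing.isLinear.Build K V V *:%R (iter k e) (@iter_is_linear K V k e).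

Lemma limg_surj (K : fieldType) (V U : vectType K) (f : {linear V -> U}) :
  (forall y, exists x, f x = y) -> limg (linfun f) = fullv.
Proof.
move=> sf; apply/eqP; rewrite eqEsubv subvf; apply/subvP => y _.
by have [x <-] := sf y; rewrite -[f x]lfunE memv_img ?memvf.
Qed.

Lemma lker0_surj (K : fieldType) (V U : vectType K) (f : {linear V -> U}) :
  (forall y, exists x, f x = y) -> dim V = dim U -> lker (linfun f) == 0%VS.
Proof.
move=> sf dVU; rewrite -dimv_eq0; apply/eqP.
have := limg_ker_dim (linfun f) fullv.
by rewrite limg_surj // capfv !dimvf dVU; lia.
Qed.

Lemma bij_dim (K : fieldType) (V U : vectType K) (f : {linear V -> U}) :
  injective f -> (forall y, exists x, f x = y) -> dim V = dim U.
Proof.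
move=> injf sf.
have kerf : lker (linfun f) == 0%VS.
  by apply/lker0P => x y; rewrite !lfunE; apply: injf.
have := limg_ker_dim (linfun f) fullv.
by rewrite limg_surj // capfv (eqP kerf) dimv0 !dimvf.
Qed.

(** * Isomorphisms of modules and splitting of extensions *)

Section Modules.
Variables (K : fieldType) (q : nat).
Implicit Types M N U A B : wmod K q.

Definition equivariant M N (f : M -> N) : Prop :=
  forall v, f (wact M v) = wact N (f v).

Lemma equivariant_iter M N (f : M -> N) k v :
  equivariant M N f -> f (iter k (wact M) v) = iter k (wact N) (f v).
Proof. by move=> ef; elim: k => //= k <-; rewrite ef. Qed.

Lemma surj_wmod_iso M N (f : {linear M -> N}) :
  equivariant M N f -> (forall y, exists x, f x = y) ->
  dim M = dim N -> wmod_iso M N.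
Proof.
move=> ef sf dMN; exists f; split=> //.
have ker_f : lker (linfun f) == 0%VS by apply: lker0_surj.
exists ((linfun f)^-1)%VF => x.
  by rewrite -[f x]lfunE lker0_lfunK.
have [y <-] := sf x.
by rewrite -{1}[f y]lfunE lker0_lfunK.
Qed.

Lemma wmod_iso_sym M N : wmod_iso M N -> wmod_iso N M.
Proof.
case=> f [[g fK gK] ef].
pose gM := GRing.isLinear.Build K N M *:%R g (can2_linear fK gK).
pose gL : {linear N -> M} := HB.pack g gM.
exists gL; split; first by exists f.
by move=> v; rewrite /= -{1}[v]gK -ef fK.
Qed.

Lemma wmod_iso_refl M : wmod_iso M M.
Proof. by exists idfun; split=> //; exists id. Qed.

Lemma wmod_iso_trans M N U : wmod_iso M N -> wmod_iso N U -> wmod_iso M U.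
Proof.
case=> f [bf ef] [g [bg eg]]; exists (g \o f); split; first exact: bij_comp.
by move=> v; rewrite /= ef eg.
Qed.

Lemma wmod_iso_dim0 M N : dim M = 0%N -> dim N = 0%N -> wmod_iso M N.
Proof.
move=> M0 N0.
have zero (V : vectType K) : dim V = 0%N -> forall v : V, v = 0.
  move=> V0 v; apply/eqP; rewrite -memv0.
  suff <- : fullv = 0%VS :> {vspace V} by rewrite memvf.
  by apply/eqP; rewrite -dimv_eq0 dimvf V0.
apply: (surj_wmod_iso _ _ \0) => [v|y|]; last by rewrite M0.
  by rewrite linear0.
by exists 0; rewrite (zero _ N0 y).
Qed.

Lemma wsum_act M N (p : M * N) : wact (wsum M N) p = (wact M p.1, wact N p.2).
Proof. by rewrite lfunE. Qed.

Lemma wsum_isor A M N : wmod_iso M N -> wmod_iso (wsum A M) (wsum A N).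
Proof.
case=> f [[g fK gK] ef].
pose h (p : A * M) : A * N := (p.1, f p.2).
have hL : linear h by move=> a u v; rewrite /h !linearP.
pose hM := GRing.isLinear.Build K (A * M)%type (A * N)%type *:%R h hL.
pose H : {linear wsum A M -> wsum A N} := HB.pack h hM.
exists H; split; last by move=> v; rewrite /= !wsum_act /h /= ef.
by exists (fun p => (p.1, g p.2)) => -[a m] /=; rewrite /h /= ?fK ?gK.
Qed.

(* The image of a linear endomorphism under the trace of K[e]/(e^N) over K:
   modules for which the identity is such a trace are relatively injective. *)
Definition identity_trace (N : nat) U : Prop :=
  exists t : 'End(U), forall u,
    \sum_(a < N) iter a (wact U) (t (iter (N - a.+1) (wact U) u)) = u.

(** Both sides are sums of terms e^a g e^(N-a), over 0 <= a < N on the left and 0 < a <= N on the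
    right. The two unmatched terms g e^N and e^N g vanish. *)
Lemma trace_equivariant (N : nat) A U (g : {linear A -> U}) :
  (forall x : A, iter N (wact A) x = 0) ->
  (forall x : U, iter N (wact U) x = 0) ->
  equivariant A U
    (fun x => \sum_(a < N) iter a (wact U) (g (iter (N - a.+1) (wact A) x))).
Proof.
move=> A0 U0 x.
case: N A0 U0 => [|N] A0 U0; first by rewrite !big_ord0 linear0.
rewrite linear_sum big_ord_recl big_ord_recr /=.
rewrite -!iterS -iterSr subSS subn0 A0 linear0 add0r.
rewrite subnn /= -!iterS U0 addr0.
apply: eq_bigr => a _; rewrite /bump /= add1n -iterSr subSS.
by rewrite subSS -subSn // subSS.
Qed.

(** By dimension, [f] and [h] together form a linear bijection from U x B, which yields a linear
    retraction of [f]. Averaging with [t] makes it equivariant, and subtracting from [h] its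
    component in the image of [f] turns [h] into a module map. *)
Lemma split_extension (N : nat) U A B (f : {linear U -> A}) (h : {linear B -> A}) :
  identity_trace N U ->
  (forall x : A, iter N (wact A) x = 0) ->
  (forall x : U, iter N (wact U) x = 0) ->
  equivariant U A f ->
  (forall x, exists u, h (wact B x) = wact A (h x) + f u) ->
  (forall x, exists u b, x = f u + h b) ->
  dim A = (dim U + dim B)%N ->
  wmod_iso A (wsum U B).
Proof.
move=> [t tE] A0 U0 ef eh surj dimA; apply: wmod_iso_sym.
pose phi (p : U * B) : A := f p.1 + h p.2.
have phiL : linear phi.
  by move=> a u v; rewrite /phi !linearP scalerDr addrACA.
pose phiM := GRing.isLinear.Build K (U * B)%type A *:%R phi phiL.
pose Phi : {linear (U * B)%type -> A} := HB.pack phi phiM.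
have [psi phiK] : exists psi : {linear A -> (U * B)%type}, forall p, psi (phi p) = p.
  have ker0 : lker (linfun Phi) == 0%VS.
    apply: lker0_surj; last by rewrite dimA.
    by move=> y; have [u [b ->]] := surj y; exists (u, b).
  exists (linfun Phi)^-1%VF => p.
  have -> : phi p = linfun Phi p by rewrite lfunE.
  by rewrite /= lker0_lfunK.
pose g (x : A) : U := t (psi x).1.
have gL : linear g by move=> a x y; rewrite /g !linearP.
pose gM := GRing.isLinear.Build K A U *:%R g gL.
pose G : {linear A -> U} := HB.pack g gM.
pose r x := \sum_(a < N) iter a (wact U) (G (iter (N - a.+1) (wact A) x)).
have er : equivariant A U r by apply: trace_equivariant.
have rL : linear r.
  move=> a x y; rewrite /r scaler_sumr -big_split; apply: eq_bigr => i _.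
  by rewrite !linearP.
pose rM := GRing.isLinear.Build K A U *:%R r rL.
pose R : {linear A -> U} := HB.pack r rM.
(* As [f] is equivariant and [psi] inverts it on the first component, the sum becomes the trace of
   [t]. *)
have rf u : r (f u) = u.
  rewrite -[RHS]tE; apply: eq_bigr => i _; congr (iter _ _ _).
  rewrite -equivariant_iter // /= /g.
  by have := phiK (iter (N - i.+1) (wact U) u, 0); rewrite /phi /= linear0 addr0 => ->.
pose s (p : U * B) : A := f p.1 + (h p.2 - f (R (h p.2))).
have sL : linear s.
  move=> a u v; rewrite /s !linearP /= !scalerDr scalerN.
  by rewrite [X in _ + X = _]addrACA [LHS]addrACA.
pose sM := GRing.isLinear.Build K (U * B)%type A *:%R s sL.
pose S : {linear wsum U B -> A} := HB.pack s sM.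
apply: (surj_wmod_iso _ _ S) => [p|y|]; last by rewrite dimA.
  (* The defect [f u] of [h] cancels against [f (R (f u))], by [rf]. *)
  rewrite wsum_act /= /s /=; have [u ->] := eh p.2.
  rewrite [r (_ + _)](linearD R) /= rf er linearD !ef [RHS]linearD linearB opprD.
  by rewrite [X in _ + X = _]addrACA subrr addr0.
have [u [b ->]] := surj y; exists (u + R (h b), b).
by rewrite /= /s /= linearD -addrA; congr (_ + _); rewrite addrC subrK.
Qed.

End Modules.

(** * Jordan blocks and their direct sums as free modules over K[e]/(e^N) *)

Section JordanBlocks.
Variable K : fieldType.

(* Basis vectors indexed by nat, [ev n a] being 0 for [a >= n]. *)
Definition ev (n a : nat) : 'rV[K]_n := \row_k (k == a :> nat)%:R.

Lemma ev_ge n a : (n <= a)%N -> ev n a = 0.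
Proof.
move=> le_na; apply/rowP => k; rewrite !mxE.
by case: eqP => // ka; have := ltn_ord k; rewrite ka ltnNge le_na.
Qed.

Lemma ev_sum n (v : 'rV[K]_n) : v = \sum_i v 0 i *: ev n i.
Proof.
rewrite {1}[v]row_sum_delta; apply: eq_bigr => i _; congr (_ *: _).
by apply/rowP => j; rewrite !mxE eqxx.
Qed.

Lemma jordan_ev n a : jordan_lfun K n (ev n a) = ev n a.+1.
Proof.
rewrite lfunE /=; apply/rowP => k; rewrite !mxE.
case: (ltnP a n) => [lt_an|le_na].
  rewrite (bigD1 (Ordinal lt_an)) //= !mxE eqxx mul1r big1 ?addr0 => [|i ne_i].
    by rewrite eq_sym.
  by rewrite !mxE -[a]/(val (Ordinal lt_an)) val_eqE (negPf ne_i) mul0r.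
rewrite big1 => [|i _].
  by case: eqP => // ka; have := ltn_ord k; rewrite ka ltnNge leqW.
rewrite !mxE; case: eqP => [ia|_]; last by rewrite mul0r.
by have := ltn_ord i; rewrite ia ltnNge le_na.
Qed.

Lemma iter_jordan_ev n k a : iter k (jordan_lfun K n) (ev n a) = ev n (k + a).
Proof. by elim: k => //= k ->; rewrite jordan_ev. Qed.

Lemma iter_jordan n k (v : 'rV[K]_n) :
  iter k (jordan_lfun K n) v = \sum_i v 0 i *: ev n (k + i).
Proof.
rewrite {1}[v]ev_sum linear_sum; apply: eq_bigr => i _.
by rewrite linearZ /= iter_jordan_ev.
Qed.

Variable q : nat.

Lemma wsum_iter (M N : wmod K q) k (p : M * N) :
  iter k (wact (wsum M N)) p = (iter k (wact M) p.1, iter k (wact N) p.2).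
Proof. by elim: k => [|k IHk]; rewrite ?iterS ?IHk ?wsum_act //; case: p. Qed.

Lemma identity_trace_wzero N : identity_trace K q N (wzero K q).
Proof. by exists 0 => u; rewrite [RHS]thinmx0 [LHS]thinmx0. Qed.

Lemma identity_trace_wsum N (A B : wmod K q) :
  identity_trace K q N A -> identity_trace K q N B ->
  identity_trace K q N (wsum A B).
Proof.
case=> [s sE] [t tE].
pose f (p : A * B) : A * B := (s p.1, t p.2).
have fL : linear f by move=> a u v; rewrite /f !linearP.
pose fM := GRing.isLinear.Build K (A * B)%type (A * B)%type *:%R f fL.
pose F : {linear (A * B)%type -> (A * B)%type} := HB.pack f fM.
exists (linfun F : 'End(wsum A B)) => -[u v].
under eq_bigr => a _ do rewrite lfunE /= /f !wsum_iter /=.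
rewrite -[in RHS](sE u) -[in RHS](tE v).
by elim/big_rec3: _ => // i x y z _ ->.
Qed.

Lemma identity_trace_W N (leN : (N <= q)%N) : identity_trace K q N (W K leN).
Proof.
case: N leN => [|N] leN; first by exists 0 => u; rewrite [RHS]thinmx0 [LHS]thinmx0.
(* The last coordinate of e^(N-a) u is u_a, so moving it to e_0 and then applying e^a recovers the
   component u_a e_a. *)
pose f (v : 'rV[K]_N.+1) : 'rV[K]_N.+1 := v 0 ord_max *: ev N.+1 0.
have fL : linear f by move=> a u v; rewrite /f !mxE scalerDl scalerA.
pose fM := GRing.isLinear.Build K _ _ *:%R f fL.
pose F : {linear 'rV[K]_N.+1 -> 'rV[K]_N.+1} := HB.pack f fM.
exists (linfun F : 'End('rV[K]_N.+1)) => u.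
rewrite [RHS]ev_sum; apply: eq_bigr => a _.
rewrite lfunE /= /f linearZ /= iter_jordan_ev addn0; congr (_ *: _).
rewrite iter_jordan summxE (bigD1 a) //= big1 => [|i ne_i].
  by rewrite !mxE subSS subnK ?eqxx ?mulr1 ?addr0 // -ltnS.
rewrite !mxE subSS; case: eqP => [/= E|_]; last by rewrite mulr0.
case/eqP: ne_i; apply: val_inj => /=; have := ltn_ord a; lia.
Qed.

Lemma identity_trace_wcopies N (leN : (N <= q)%N) d :
  identity_trace K q N (wcopies (W K leN) d).
Proof.
elim: d => [|d IHd]; first exact: identity_trace_wzero.
exact: identity_trace_wsum (identity_trace_W _ _) IHd.
Qed.

Lemma wcopies_nilp N (leN : (N <= q)%N) d (x : wcopies (W K leN) d) :
  iter N (wact (wcopies (W K leN) d)) x = 0.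
Proof.
elim: d x => [|d IHd] x; first exact: thinmx0.
rewrite [wact _]/(wact (wsum _ _)) wsum_iter IHd; congr (_, _).
(* A block is killed at its own size [N], so the lemma is applied with [N] in place of the ambient
   [q]. *)
exact: (jordan_nilp (q := N)).
Qed.

Lemma dim_wcopies N (leN : (N <= q)%N) d :
  dim (wcopies (W K leN) d) = (d * N)%N.
Proof.
elim: d => [|d IHd]; first by rewrite [LHS]dim_matrix.
rewrite [LHS]/(dim (W K leN) + dim (wcopies (W K leN) d))%N IHd mulSn.
by congr (_ + _)%N; rewrite [LHS]dim_matrix mul1r.
Qed.

(** W_N is free of rank one over K[e]/(e^N), so its generator can be sent to any vector of a module
    killed by e^N. *)
Lemma wcopies_generators N (leN : (N <= q)%N) (A : wmod K q) (v : nat -> A) d :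
  (0 < N)%N -> (forall x : A, iter N (wact A) x = 0) ->
  exists f : {linear wcopies (W K leN) d -> A},
    equivariant K q _ A f /\ forall i, (i < d)%N -> exists u, f u = v i.
Proof.
move=> N_gt0 A0.
(* The coordinates of [c] are read as the coefficients of a polynomial in e, applied to [x]. *)
pose g (x : A) (c : 'rV[K]_N) : A := \sum_(i < N) c 0 i *: iter i (wact A) x.
have gL x : linear (g x).
  move=> a c c'; rewrite /g scaler_sumr -big_split; apply: eq_bigr => i _ /=.
  by rewrite !mxE scalerDl scalerA.
have eg x : equivariant K q (W K leN) A (g x).
  move=> c; rewrite [in LHS](ev_sum _ c) linear_sum.
  pose gM := GRing.isLinear.Build K 'rV[K]_N A *:%R (g x) (gL x).
  pose G : {linear 'rV[K]_N -> A} := HB.pack (g x) gM.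
  rewrite -[g x]/(G : _ -> _) [in LHS]linear_sum [in RHS]/= /g linear_sum.
  apply: eq_bigr => i _; rewrite !linearZ /= jordan_ev -iterS; congr (_ *: _).
  case: (ltnP i.+1 N) => [lt_iN|le_Ni].
    rewrite /g (bigD1 (Ordinal lt_iN)) //= mxE eqxx scale1r big1 ?addr0 // => j.
    by rewrite mxE -val_eqE /= => /negPf->; rewrite scale0r.
  (* At the top index both sides vanish: [ev N N] is 0 and e^N kills [x]. *)
  have -> : i.+1 = N by apply/eqP; rewrite eqn_leq le_Ni ltn_ord.
  rewrite A0 /g big1 // => j _; rewrite mxE.
  by have := ltn_ord j; case: eqP => [->|]; rewrite ?ltnn // scale0r.
have g1 x : g x (ev N 0) = x.
  rewrite /g (bigD1 (Ordinal N_gt0)) //= mxE eqxx scale1r big1 ?addr0 // => j.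
  by rewrite mxE -val_eqE /= => /negPf->; rewrite scale0r.
elim: d => [|d [f [ef fv]]].
  by exists \0; split=> // x; rewrite /= linear0.
pose h (p : W K leN * wcopies (W K leN) d) : A := g (v d) p.1 + f p.2.
have hL : linear h.
  by move=> a u w; rewrite /h /= gL linearP scalerDr addrACA.
pose hM := GRing.isLinear.Build K (W K leN * wcopies (W K leN) d)%type A *:%R h hL.
pose H : {linear wcopies (W K leN) d.+1 -> A} := HB.pack h hM.
exists H; split=> [p|i].
  by rewrite [wact _]/(wact (wsum _ _)) wsum_act /= /h /= eg ef linearD.
rewrite ltnS leq_eqVlt => /orP[/eqP->|/fv[u fu]].
  by exists (ev N 0, 0); rewrite /= /h /= g1 linear0 addr0.
exists (0, u); rewrite /= /h /= fu.
by have := gL (v d) (-1) 0 0; rewrite scaler0 addr0 scaleN1r addNr => ->; rewrite add0r.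
Qed.

End JordanBlocks.

(** * Dimension of the exterior square *)

Lemma card_ltn_pairs m : #|[set u : 'I_m * 'I_m | (u.1 < u.2)%N]| = 'C(m, 2).
Proof.
rewrite cardsE -sum1_card.
rewrite -(pair_big_dep xpredT (fun i j : 'I_m => (i < j)%N) (fun _ _ => 1%N)) /=.
rewrite (exchange_big_dep predT) //=.
rewrite -bin2_sum big_mkord; apply: eq_bigr => j _.
by rewrite -(big_ord_widen m (fun=> 1%N)) ?sum1_card ?card_ord // ltnW.
Qed.

(** A matrix B - B^T has zero diagonal in every characteristic, so it is determined by its entries
    above the diagonal, which are arbitrary. *)
Lemma dim_ext2 (K : fieldType) (V : vectType K) : dim (ext2 V) = 'C(dim V, 2).
Proof.
rewrite -[in RHS]dimvf -card_ltn_pairs; set m := \dim _; set P := [set u | _].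
pose g (x : ext2 V) : 'rV[K]_#|P| :=
  \row_k vsval x (enum_val k).1 (enum_val k).2.
have gL : linear g by move=> a x y; apply/rowP => k; rewrite !mxE.
pose gM := GRing.isLinear.Build K (ext2 V) 'rV[K]_#|P| *:%R g gL.
pose G : {linear ext2 V -> 'rV[K]_#|P|} := HB.pack g gM.
have entry (x : ext2 V) i j : vsval x j i = - vsval x i j.
  have /memv_imgP[B _ ->] := subvsP x.
  by rewrite lfunE /= /antisym_fun !mxE opprB.
have diag (x : ext2 V) i : vsval x i i = 0.
  have /memv_imgP[B _ ->] := subvsP x.
  by rewrite lfunE /= /antisym_fun !mxE subrr.
rewrite (bij_dim _ _ _ G) ?dim_matrix ?mul1r // => [x y eq_xy|y].
  have lt_eq (i j : 'I_m) : (i < j)%N -> vsval x i j = vsval y i j.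
    move=> lt_ij; have Pij : (i, j) \in P by rewrite inE.
    have /rowP/(_ (enum_rank_in Pij (i, j))) := eq_xy.
    by rewrite !mxE enum_rankK_in.
  apply: val_inj; apply/matrixP => i j /=.
  case: (ltngtP i j) => [/lt_eq //|/lt_eq eq_ji|/val_inj ->].
    by rewrite entry [RHS]entry eq_ji.
  by rewrite !diag.
(* [C] is strictly upper triangular, so subtracting its transpose leaves the entries above the
   diagonal unchanged. *)
pose C : 'M[K]_m := \sum_k y 0 k *: delta_mx (enum_val k).1 (enum_val k).2.
exists (vsproj (limg (antisym V)) (antisym V C)); apply/rowP => k.
rewrite !mxE vsprojK ?memv_img ?memvf // lfunE /= /antisym_fun !mxE.
rewrite !summxE (bigD1 k) //= !mxE !eqxx mulr1 big1 => [|l ne_lk].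
  rewrite big1 ?addr0 ?subr0 // => l _; rewrite !mxE.
  case: eqP => [e1|_]; last by rewrite mulr0.
  case: eqP => [e2|_]; last by rewrite mulr0.
  have := enum_valP l; have := enum_valP k; rewrite !inE -e1 -e2 => lt_kl /(ltn_trans lt_kl).
  by rewrite ltnn.
rewrite !mxE; case: eqP => [e1|_]; last by rewrite mulr0.
case: eqP => [e2|_]; last by rewrite mulr0.
case/eqP: ne_lk; apply: enum_val_inj.
by rewrite [LHS]surjective_pairing [RHS]surjective_pairing e1 e2.
Qed.

(** * Generators and nilpotency of the exterior square of a Jordan block *)

Section ExteriorSquareJordan.
Variables (K : fieldType) (char2 : 2%N \in [pchar K]).

Lemma addrr_char2 (V : lmodType K) (x : V) : x + x = 0.
Proof. by rewrite -mulr2n -scaler_nat (pcharf0 char2) scale0r. Qed.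

Section Wedge.
Variable V : vectType K.

Lemma wedgeDr (u v w : V) : wedge u (v + w) = wedge u v + wedge u w.
Proof.
have [linr _ _] := wedge_alternating V.
by have := linr u 1 v w; rewrite !scale1r.
Qed.

Lemma wedgevv (u : V) : wedge u u = 0.
Proof. by have [_ _ ->] := wedge_alternating V. Qed.

Lemma wedge0 (u : V) : wedge u 0 = 0.
Proof. by apply: (@addrI _ (wedge u 0)); rewrite -wedgeDr !addr0. Qed.

Lemma wedgeC (u v : V) : wedge v u = wedge u v.
Proof.
rewrite (alternatingN u v (wedge_alternating V)); apply/eqP.
by rewrite eq_sym -addr_eq0 addrr_char2.
Qed.

Lemma wedge0l (u : V) : wedge 0 u = 0.
Proof. by rewrite wedgeC wedge0. Qed.

End Wedge.

Notation S n := (ext2_act (jordan_lfun K n)).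
Notation w n a b := (wedge (ev K n a) (ev K n b)).

Lemma ext2_act_ev n a b : S n (w n a b) = w n a.+1 b + w n a b.+1.
Proof. by rewrite ext2_act_wedge !jordan_ev. Qed.

Lemma iter_ext2_ev n x a b :
  iter (2 ^ x) (S n) (w n a b) = w n (2 ^ x + a) b + w n a (2 ^ x + b).
Proof. by rewrite iter_ext2_act // !iter_jordan_ev. Qed.

(** [ext2_span] refers to the abstract basis [vbasis]; bilinearity transfers spanning to the vectors
    [ev]. *)
Lemma ext2_ev_span n (G : {vspace ext2 'rV[K]_n}) :
  (forall a b, w n a b \in G) -> G = fullv.
Proof.
move=> wG; apply/eqP; rewrite eqEsubv subvf; apply/subvP => x _.
have [linr linl _] := wedge_alternating 'rV[K]_n.
have sumr (u v : 'rV[K]_n) : wedge u v = \sum_i v 0 i *: wedge u (ev K n i).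
  pose fM := GRing.isLinear.Build K 'rV[K]_n _ *:%R (wedge u) (linr u).
  pose F : {linear 'rV[K]_n -> _} := HB.pack (wedge u) fM.
  rewrite {1}(ev_sum _ _ v) -[wedge u]/(F : _ -> _) linear_sum.
  by apply: eq_bigr => i _; rewrite linearZ.
have [B ->] := ext2_span x.
apply: memv_suml => i _; apply: memv_suml => j _; apply: memvZ.
rewrite sumr; apply: memv_suml => k _; apply: memvZ.
rewrite wedgeC sumr; apply: memv_suml => l _; exact: memvZ.
Qed.

(* [S (w l (l + k + 1)) = w (l + 1) (l + k + 1) + w l (l + k + 2)], so the
   [w l (l + 1)] generate the exterior square under [S]. *)
Lemma ext2_ev_generated n (G : {vspace ext2 'rV[K]_n}) :
  (forall x, x \in G -> S n x \in G) -> (forall l, w n l l.+1 \in G) ->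
  G = fullv.
Proof.
move=> SG vG.
(* Induction on the gap between the indices, carrying two consecutive gaps because the recurrence
   has order two. *)
have G2 k : (forall l, w n l (l + k) \in G) /\ (forall l, w n l (l + k.+1) \in G).
  elim: k => [|k [IH0 IH1]].
    by split=> l; rewrite ?addn1 // addn0 wedgevv mem0v.
  split=> // l; have := SG _ (IH1 l); rewrite ext2_act_ev.
  by rewrite [w n l.+1 _](_ : _ = w n l.+1 (l.+1 + k)) ?addSnnS // !addnS rpredDl.
apply: ext2_ev_span => a b; wlog le_ab: a b / (a <= b)%N.
  by move=> H; case/orP: (leq_total a b) => /H //; rewrite wedgeC.
by rewrite -(subnKC le_ab); have [] := G2 (b - a)%N.
Qed.

(** Induction along 2^(x+1) - 1 = 2^x + (2^x - 1): applying the derivation e^(2^x) to e_l /\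
    e_(2^x+l) gives a square, which vanishes, and the next value. *)
Lemma iter_pred_ext2_ev n x l :
  iter (2 ^ x - 1) (S n) (w n l l.+1) = w n l (2 ^ x + l).
Proof.
elim: x => [|x IHx]; first by rewrite /= add1n.
have -> : (2 ^ x.+1 - 1 = 2 ^ x + (2 ^ x - 1))%N.
  by rewrite expnS; have := expn_gt0 2 x; lia.
rewrite iterD IHx iter_ext2_ev wedgevv add0r addnA addnn -mul2n.
by rewrite -expnS.
Qed.

(** The derivation property alone gives the exponent 2^x. Gaining one on the generators, hence
    everywhere, is the source of the block size 2^x - 1. *)
Lemma ext2_nilp_pred n x (le_n : (n <= 2 ^ x)%N) (u : ext2 'rV[K]_n) :
  iter (2 ^ x - 1) (S n) u = 0.
Proof.
set k := (_ - 1)%N.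
suff: lker (linfun (iter k (S n))) = fullv.
  by move=> kerE; apply/eqP; rewrite -[iter _ _ _]lfunE -memv_ker kerE memvf.
apply: ext2_ev_generated => [v|l]; rewrite !memv_ker ![linfun (iter _ _) _]lfunE /=.
  by move/eqP=> v0; rewrite -iterSr iterS v0 linear0.
by rewrite iter_pred_ext2_ev (ev_ge _ _ (_ + l)) ?wedge0 // (leq_trans le_n) ?leq_addr.
Qed.

End ExteriorSquareJordan.

(** * Reflection from h + j to h - j *)

Lemma bin2_reflect h j : (j <= h)%N ->
  'C(h + j, 2) = (j * (2 * h - 1) + 'C(h - j, 2))%N.
Proof.
move=> le_jh.
(* Once doubled, with n = h + j and m = h - j, the claim reads n^2 - m^2 - (n - m) = 2j(2h - 1). *)
have bin2E n : (2 * 'C(n, 2) = n * n.-1)%N by rewrite -mul_bin_diag bin1.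
have := bin2E (h + j)%N; have := bin2E (h - j)%N.
by move: (h - j)%N (subnKC le_jh) => m <-; case: m => [|m]; case: j le_jh => [|j] _; nia.
Qed.

Section ReflectionStep.
Variables (K : fieldType) (char2 : 2%N \in [pchar K]) (alpha x j : nat).
Local Notation h := (2 ^ x)%N.
Local Notation n := (h + j)%N.
Local Notation m := (h - j)%N.
Hypothesis le_jh : (j <= h)%N.
Hypothesis le_n : (n <= 2 ^ alpha)%N.
Hypothesis le_m : (m <= 2 ^ alpha)%N.
Hypothesis le_N : (2 ^ x.+1 - 1 <= 2 ^ alpha)%N.

Notation S n := (ext2_act (jordan_lfun K n)).
Notation w n a b := (wedge (ev K n a) (ev K n b)).

(** Not a module map in general: e kills the last basis vector of W_m, but sends its shift e_(h-1)
    to e_h. *)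
Definition shift (v : 'rV[K]_m) : 'rV[K]_n := \sum_i v 0 i *: ev K n (j + i).

Lemma shift_linear : linear shift.
Proof.
move=> a u v; rewrite /shift scaler_sumr -big_split; apply: eq_bigr => i _ /=.
by rewrite !mxE scalerDl scalerA.
Qed.

HB.instance Definition _ :=
  GRing.isLinear.Build K 'rV[K]_m 'rV[K]_n *:%R shift shift_linear.

Lemma shift_ev a : (a < m)%N -> shift (ev K m a) = ev K n (j + a).
Proof.
move=> lt_am; rewrite /shift (bigD1 (Ordinal lt_am)) //= mxE eqxx scale1r.
rewrite big1 ?addr0 // => i; rewrite mxE -val_eqE /= => /negPf->.
by rewrite scale0r.
Qed.

Lemma ext2_shift_ex : exists f : {linear ext2 'rV[K]_m -> ext2 'rV[K]_n},
  forall u v, f (wedge u v) = wedge (shift u) (shift v).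
Proof.
have [linr linl alt] := wedge_alternating 'rV[K]_n.
have [_ univ] := exterior_squareP 'rV[K]_m.
have [|f [fE _]] := univ _ (fun u v => wedge (shift u) (shift v)).
  by split=> [v a u u'|v a u u'|v]; rewrite ?linearP ?linr ?linl ?alt.
by exists f.
Qed.

Section Submodule.
Variable F : {vspace ext2 'rV[K]_n}.
Hypothesis SF : forall u, u \in F -> S n u \in F.
Hypothesis vF : forall l, (l < j)%N -> w n l l.+1 \in F.

Lemma iter_sub k u : u \in F -> iter k (S n) u \in F.
Proof. by move=> uF; elim: k => //= k; apply: SF. Qed.

(** The preimage of [F] under e^h is stable under e, so testing generators suffices. For l >= j,
    both h + l and h + l + 1 reach n, and both terms vanish. *)
Lemma iter_expn_sub u : iter h (S n) u \in F.
Proof.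
suff: (linfun (iter h (S n)) @^-1: F)%VS = fullv.
  by move=> preE; rewrite -[iter _ _ _]lfunE memv_preim preE memvf.
apply: ext2_ev_generated => // [v|l]; rewrite -!memv_preim ![linfun (iter _ _) _]lfunE /=.
  by move=> vF'; rewrite -iterSr iterS SF.
case: (ltnP l j) => [/vF/iter_sub //|le_jl].
rewrite iter_ext2_ev // !(ev_ge K n (h + _)) ?leq_add2l 1?leqW //.
by rewrite wedge0 (wedge0l _ char2) addr0 mem0v.
Qed.

(** Since h + a >= n, this vector is e^h applied to e_a /\ e_(b-h). *)
Lemma wedge_ev_sub a b : (j <= a)%N -> (h <= b)%N -> w n a b \in F.
Proof.
move=> le_ja le_hb; have := iter_expn_sub (w n a (b - h)).
rewrite iter_ext2_ev // (ev_ge K n (h + a)) ?leq_add2l //.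
by rewrite (wedge0l _ char2) add0r subnKC.
Qed.

Variable f : {linear ext2 'rV[K]_m -> ext2 'rV[K]_n}.
Hypothesis fE : forall u v, f (wedge u v) = wedge (shift u) (shift v).

Lemma ext2_shift_equivariant_mod u : f (S m u) - S n (f u) \in F.
Proof.
pose d := ((linfun f \o S m) - (S n \o linfun f))%VF.
have dE v : d v = f (S m v) - S n (f v).
  by rewrite add_lfunE opp_lfunE !comp_lfunE ![linfun f _]lfunE.
rewrite -dE memv_preim; suff -> : (d @^-1: F)%VS = fullv by rewrite memvf.
apply: (ext2_ev_span _ char2) => a b; rewrite -memv_preim.
case: (ltnP a m) => [lt_am|le_ma]; last first.
  by rewrite (ev_ge K m a) // (wedge0l _ char2) linear0 mem0v.
case: (ltnP b m) => [lt_bm|le_mb]; last first.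
  by rewrite (ev_ge K m b) // wedge0 linear0 mem0v.
(* Only c = m - 1 gives a nontrivial difference, and there the missing vector is e_(j+m) = e_h, so
   [wedge_ev_sub] applies. *)
have shiftS c d' : (c < m)%N ->
    wedge (ev K n (j + d')) (shift (ev K m c.+1)) - w n (j + d') (j + c).+1 \in F.
  rewrite leq_eqVlt => /orP[/eqP c_m|lt_cm].
    rewrite (ev_ge K m c.+1) ?c_m // linear0 wedge0 sub0r rpredN -addnS c_m.
    by rewrite wedge_ev_sub ?leq_addr // subnKC.
  by rewrite shift_ev // addnS subrr mem0v.
rewrite dE ext2_act_ev linearD /= !fE !(shift_ev a) // !(shift_ev b) //.
rewrite ext2_act_ev opprD addrACA rpredD ?shiftS //.
by rewrite !(wedgeC _ char2 _ (ev K n (j + b))) shiftS.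
Qed.

Lemma addv_ext2_shift : (F + limg (linfun f))%VS = fullv.
Proof.
apply: (ext2_ev_generated _ char2) => [u|l].
  case/memv_addP=> u1 u1F [_ /memv_imgP[u2 _ ->] ->].
  rewrite [linfun f _]lfunE linearD /= -[S n (f u2)](subrK (f (S m u2))).
  rewrite addrA; apply: memv_add; last by rewrite -[f _]lfunE memv_img ?memvf.
  rewrite -opprB; apply: rpredB; first exact: SF.
  exact: ext2_shift_equivariant_mod.
(* Three ranges: for l < j the generator is in [F] by assumption, for l + 1 >= h by [wedge_ev_sub],
   and in between it is the shift of the generator at l - j. *)
case: (ltnP l j) => [/vF vlF|le_jl].
  by apply: subvP vlF; apply: addvSl.
case: (leqP h l.+1) => [le_hl|lt_lh].
  by apply: (subvP (addvSl _ _)); apply: wedge_ev_sub.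
apply: (subvP (addvSr _ _)).
have -> : w n l l.+1 = linfun f (w m (l - j) (l - j).+1).
  by rewrite lfunE /= fE !shift_ev ?addnS ?subnKC //; lia.
by rewrite memv_img ?memvf.
Qed.

End Submodule.

(** Freeness of the submodule generated by the first j generators is not checked directly:
    injectivity of [g] follows from spanning and the dimension count, inside [split_extension]. *)
Theorem ext2_reflection :
  wmod_iso (wedge2 char2 (W K le_n))
           (wsum (wcopies (W K le_N) j) (wedge2 char2 (W K le_m))).
Proof.
have A0 (u : wedge2 char2 (W K le_n)) :
    iter (2 ^ x.+1 - 1) (wact (wedge2 char2 (W K le_n))) u = 0.
  by apply: ext2_nilp_pred; rewrite ?expnS ?mul2n -?addnn ?leq_add2l.
have N_gt0 : (0 < 2 ^ x.+1 - 1)%N.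
  by rewrite expnS; have := expn_gt0 2 x; lia.
have [g [eg gv]] :=
  wcopies_generators K _ _ le_N (wedge2 char2 (W K le_n)) (fun i => w n i i.+1) j N_gt0 A0.
have [f fE] := ext2_shift_ex.
pose F := limg (linfun g).
have gF u : g u \in F by rewrite -[g u]lfunE memv_img ?memvf.
have Fg u : u \in F -> exists c, u = g c.
  by case/memv_imgP => c _ ->; exists c; rewrite lfunE.
have SF u : u \in F -> S n u \in F.
  by case/Fg => c ->; rewrite -[S n _](eg c).
have vF l : (l < j)%N -> w n l l.+1 \in F.
  by case/gv => c <-.
apply: (split_extension K _ (2 ^ x.+1 - 1) (wcopies (W K le_N) j)
  (wedge2 char2 (W K le_n)) (wedge2 char2 (W K le_m)) g f) => // [|c|u|u|].
- exact: identity_trace_wcopies.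
- exact: wcopies_nilp.
- have /Fg[c def_c] := ext2_shift_equivariant_mod F SF vF f fE u.
  by exists c; rewrite -def_c addrC subrK.
- have : u \in (F + limg (linfun f))%VS by rewrite addv_ext2_shift ?memvf.
  case/memv_addP=> _ /Fg[c ->] [_ /memv_imgP[b _ ->] ->].
  by exists c, b; rewrite lfunE.
rewrite dim_wcopies !dim_ext2 !dim_matrix !mul1r bin2_reflect //.
by rewrite expnS.
Qed.

End ReflectionStep.

(** * Induction along the consecutive-ones expansion *)

Lemma big_ord_recl_cond (R : Type) (idx : R) (op : R -> R -> R) n
    (P : pred 'I_n.+1) (F : 'I_n.+1 -> R) :
  let r := \big[op/idx]_(i < n | P (lift ord0 i)) F (lift ord0 i) in
  \big[op/idx]_(i < n.+1 | P i) F i = if P ord0 then op (F ord0) r else r.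
Proof.
(* The index list is peeled directly, with no monoid law on [op]: [wsum] is associative only up to
   isomorphism. *)
have -> : index_enum 'I_n.+1 = ord0 :: map (lift ord0) (index_enum 'I_n).
  by rewrite ![index_enum _]unlock -!enumT enum_ordSl.
by rewrite /= big_cons big_map.
Qed.

Lemma altsum_ge0 b : sorted gtn b -> 0 <= altsum b.
Proof.
case: b => [|y s]; first by rewrite altsum_nil.
(* [y.+1] serves as an artificial strict bound above the leading exponent. *)
move=> srt; suff /altsum_bound/andP[] : path gtn y.+1 (y :: s) by [].
by rewrite /= ltnSn.
Qed.

(** Only terms after position k enter, with signs relative to k, so a new leading term changes
    nothing. *)
Lemma dcoef_cons y s k : (k < size s)%N -> dcoef (y :: s) k.+1 = dcoef s k.
Proof. by move=> lt_ks; rewrite !dcoefE. Qed.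

(* The bound on tails is what minimality of the expansion means for [b], in a
   form inherited by tails. *)
Lemma ext2_W_decomposition (K : fieldType) (char2 : 2%N \in [pchar K])
    (alpha : nat) (b : seq nat) (n : nat) (le_n : (n <= 2 ^ alpha)%N)
    (le_b : forall k : 'I_(size b), (2 ^ nth 0 b k - 1 <= 2 ^ alpha)%N) :
  sorted gtn b -> altsum b = n%:Z ->
  (forall k, (k < size b)%N -> (0 < nth 0 b k)%N ->
     altsum (drop k.+1 b) < 2 ^+ (nth 0%N b k).-1) ->
  wmod_iso
    (wedge2 char2 (W K le_n))
    (\big[@wsum K (2 ^ alpha)%N / wzero K (2 ^ alpha)%N]_(k < size b | (0 < nth 0 b k)%N)
       wcopies (W K (le_b k)) `|dcoef b k|%N).
Proof.
elim: b n le_n le_b => [|y s IHs] n le_n le_b srt sum_n tail_lt.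
  rewrite big_ord0; apply: wmod_iso_dim0; last by rewrite [LHS]dim_matrix.
  move: sum_n; rewrite altsum_nil => -[n0]; subst n.
  by rewrite [LHS]dim_ext2 dim_matrix.
have srt_s : sorted gtn s by apply: path_sorted srt.
have IH := IHs _ _ (fun k => le_b (lift ord0 k)) srt_s _
  (fun k lt_k => tail_lt k.+1 lt_k).
rewrite [\big[_/_]_(_ < _ | _) _]big_ord_recl_cond /=.
case: y srt sum_n tail_lt le_b IH => [|y] srt sum_n tail_lt le_b IH.
  (* Exponent 0 can only come last, so here n = 1 and both sides are zero. *)
  clear IHs tail_lt IH srt_s; case: s srt sum_n le_b => [|z s] // _.
  rewrite altsum_cons altsum_nil subr0 expr0 => -[n1] le_b; subst n.
  rewrite big_ord0; apply: wmod_iso_dim0; last by rewrite [LHS]dim_matrix.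
  by rewrite [LHS]dim_ext2 dim_matrix.
(* The tail sums to some m with 0 <= m < 2^y, and n = 2^(y+1) - m is its reflection. The number of
   copies split off, j = 2^y - m, is the leading coefficient [dcoef]. *)
have /gez0_abs altsum_s := altsum_ge0 _ srt_s.
move: (absz _) altsum_s => m altsum_s.
have := tail_lt 0%N isT isT; rewrite /= drop0 -altsum_s.
rewrite -[2]/(2%:R : int) -natrX -[m%:Z]natz ltr_nat => lt_m.
have def_n : n = (2 ^ y.+1 - m)%N.
  apply/eqP; rewrite -(eqr_nat int) natrB; last first.
    by rewrite (leq_trans (ltnW lt_m)) ?leq_exp2l.
  by rewrite !natz -sum_n altsum_cons -altsum_s -[Posz (2 ^ _)]natz natrX.
have def_d : `|dcoef (y.+1 :: s) 0|%N = (2 ^ y - m)%N.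
  rewrite dcoefE //= drop0 -altsum_s -[2]/(2%:R : int) -natrX -[m%:Z]natz.
  by rewrite -natrB ?(ltnW lt_m) // natz.
have le_m : (m <= 2 ^ alpha)%N.
  apply: leq_trans le_n; rewrite def_n expnS; lia.
have {}IH := IH m le_m (esym altsum_s).
have hn : n = (2 ^ y + (2 ^ y - m))%N by rewrite def_n expnS; lia.
have hm : m = (2 ^ y - (2 ^ y - m))%N by rewrite subKn // ltnW.
rewrite def_d; move: (2 ^ y - m)%N (leq_subr m (2 ^ y)) hn hm => j le_j hn hm.
clear - IH le_j hn hm; subst n m.
apply: wmod_iso_trans (ext2_reflection _ char2 _ _ _ le_j le_n le_m (le_b ord0)) _.
apply: wsum_isor; apply: wmod_iso_trans IH _.
rewrite [X in wmod_iso X](_ : _ = \big[@wsum K _ / wzero K _]_(i < size s | (0 < nth 0 s i)%N)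
  wcopies (W K (le_b (lift ord0 i))) `|dcoef (y.+1 :: s) (bump 0 i)|%N).
  exact: wmod_iso_refl.
by apply: eq_bigr => k _; rewrite /bump add1n dcoef_cons.
Qed.

Theorem theorem1p6 (K : fieldType) (char2 : 2%N \in [pchar K])
    (alpha : nat) (alpha_gt0 : (0 < alpha)%N)
    (n : nat) (n_gt0 : (0 < n)%N) (n_le : (n <= 2 ^ alpha)%N)
    (b : seq nat) (expn : consecutive_ones n b) :
  wmod_iso
    (wedge2 char2 (W K n_le))
    (\big[@wsum K (2 ^ alpha)%N / wzero K (2 ^ alpha)%N]_(k < size b | (0 < nth 0 b k)%N)
       wcopies (W K (consecutive_ones_bound expn n_le (ltn_ord k)))
               `|dcoef b k|%N).
Proof.
have [srt sum_n _] := expn.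
apply: (ext2_W_decomposition _ _ _ _ _ _
  (fun k => consecutive_ones_bound expn n_le (ltn_ord k))) => // k lt_k bk_gt0.
(* Minimality of [b] gives the tail bound, after splitting [b] at position [k]. *)
apply: (consecutive_ones_tail (n := n) (p := take k b)) => //.
by rewrite -drop_nth // cat_take_drop.
Qed.
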